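(* Let $G=\mathbb{Z}_{n_1}\times\cdots\times\mathbb{Z}_{n_s}\times\mathbb{Z}_{n_{s+1}}\times\cdots\times\mathbb{Z}_{n_k}$, where $n_1,\dots,n_s$ are even and $n_{s+1},\dots,n_k$ are odd. Then the number of associative $G$-graded twisted $\mathbb{R}$-algebras, up to graded isomorphism, is exactly $2^{s(s+1)/2}$.
   Context: Let $K$ be a field and $G$ a group with identity $e$. A $G$-graded twisted $K$-algebra is a (not necessarily associative) $K$-algebra $W$ with a $G$-grading $W=\bigoplus_{g\in G}W_g$, $W_aW_b\subset W_{ab}$, such that each $W_g$ is a one-dimensional $K$-vector space, $w_a\cdot w_b\neq 0$ for all nonzero $w_a\in W_a$, $w_b\in W_b$ (all $a,b\in G$), and $W$ has a multiplicative identity element $1\in W_e$. It is associative if its multiplication is associative. Two $G$-graded twisted $K$-algebras $W,V$ are graded-isomorphic if there is a unital $K$-algebra isomorphism $\varphi:W\to V$ with $\varphi(W_g)\subset V_g$ for all $g\in G$. $\mathbb{Z}_n$ denotes the cyclic group of order $n$. *)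

(* Defs.v *)
From mathcomp Require Import all_boot all_order all_fingroup all_algebra.
From mathcomp Require Import reals.

Set Implicit Arguments.
Unset Strict Implicit.
Unset Printing Implicit Defensive.

Import GRing.Theory.
Local Open Scope ring_scope.

(* The algebra is not assumed associative, so the product is a bare bilinear  *)
(* map on a vector space rather than a ring structure. Finite dimensionality  *)
(* (vectType) is no restriction here: G is finite and W is the direct sum of  *)
(* the one-dimensional spaces tw_comp g.                                      *)
Record twistedAlg (K : fieldType) (G : finGroupType) := TwistedAlg {
  tw_sort :> vectType K;
  tw_mul : tw_sort -> tw_sort -> tw_sort;
  tw_one : tw_sort;
  tw_comp : G -> {vspace tw_sort};
  tw_mul_linear_r : forall x, linear (tw_mul x);
  tw_mul_linear_l : forall y, linear (tw_mul ^~ y);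
  tw_direct : directv (\sum_(g : G) tw_comp g);
  tw_full : (\sum_(g : G) tw_comp g)%VS = fullv;
  tw_mul_comp : forall (a b : G) x y,
    x \in tw_comp a -> y \in tw_comp b -> tw_mul x y \in tw_comp (a * b)%g;
  tw_dim1 : forall g, \dim (tw_comp g) = 1%N;
  tw_mul_neq0 : forall (a b : G) x y, x \in tw_comp a -> y \in tw_comp b ->
    x != 0 -> y != 0 -> tw_mul x y != 0;
  tw_one_comp : tw_one \in tw_comp 1%g;
  tw_mul1l : forall x, tw_mul tw_one x = x;
  tw_mul1r : forall x, tw_mul x tw_one = x
}.

Definition tw_associative (K : fieldType) (G : finGroupType)
    (W : twistedAlg K G) : Prop :=
  associative (@tw_mul K G W).

Definition graded_isomorphic (K : fieldType) (G : finGroupType)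
    (W V : twistedAlg K G) : Prop :=
  exists phi : {linear W -> V},
    [/\ bijective phi,
        phi (tw_one W) = tw_one V,
        forall x y, phi (tw_mul x y) = tw_mul (phi x) (phi y)
      & forall (g : G) x, x \in tw_comp W g -> phi x \in tw_comp V g].

(* The objects of T satisfying P form exactly N classes up to E: there is a   *)
(* list of N pairwise inequivalent representatives meeting every class.       *)
Definition count_up_to (T : Type) (E : T -> T -> Prop) (P : T -> Prop)
    (N : nat) : Prop :=
  exists rep : 'I_N -> T,
    [/\ forall i, P (rep i),
        forall i j, E (rep i) (rep j) -> i = j
      & forall x, P x -> exists i, E x (rep i)].

(* For 0 < n, 'I_n.-1.+1 is the cyclic group of order n under addition; 'Z_n  *)
(* is not usable because 'Z_1 has two elements and n = 1 is an allowed odd    *)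
(* order.                                                                     *)
Definition cyclic_prod (k : nat) (n : 'I_k -> nat) : finGroupType :=
  {dffun forall i : 'I_k, 'I_(n i).-1.+1}.

(* Main.v *)
Require Import Defs.
From HB Require Import structures.
From mathcomp Require Import all_boot all_order all_fingroup all_algebra.
From mathcomp Require Import reals zify ring.

(** Choosing a nonzero vector [w g] in every component of an associative
    twisted algebra gives [w a * w b = sigma a b *: w (a * b)], where [sigma] is
    a nowhere zero 2-cocycle; rescaling the [w g] changes [sigma] by a
    coboundary. Hence graded isomorphism classes are classes of cocycles modulo
    coboundaries ([graded_isomorphicP], [cocycle_alg]), and what has to be
    counted is H^2(G, R^* ) for G a product of cyclic groups acting trivially.

    A cocycle class is detected by signs attached to the generators e_i of even
    order n_i: for each such i the sign of the scalar by which the n_i-th power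
    of w(e_i) differs from the identity, and for each pair i < j of them the
    sign by which w(e_i) and w(e_j) commute. Commutation is a bimultiplicative
    form, so it is a root of unity, i.e. +1 or -1, on even generators and
    trivial as soon as one of the generators has odd order; and a real number
    has an n-th root if it is positive or n is odd. So if all those signs are
    positive, the w(e_i) commute and can be rescaled to satisfy
    w(e_i)^n_i = 1. The central extension of G by R^* that the cocycle defines
    is then commutative, and the relations of G lift to it, so that it splits:
    the cocycle is a coboundary ([positive_invariants_split]).

    Conversely every choice of signs occurs. The carry of the addition in the
    i-th coordinate, and the products (parity of a_i) * (parity of b_j) for
    i < j, are cocycles modulo 2, whose exponentials form a basis dual to the
    family of invariants ([invariant_elementary]). The classes therefore
    correspond to the subsets of the set of pairs i <= j < s, which has
    s(s+1)/2 elements. *)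

Set Implicit Arguments.
Unset Strict Implicit.
Unset Printing Implicit Defensive.

Import Order.TTheory GRing.Theory Num.Theory.

(** * Cocycles with values in the nonzero elements of a field *)

Section Cocycles.
Local Open Scope ring_scope.
Variables (K : fieldType) (G : finGroupType).
Implicit Types (sigma tau : G -> G -> K).

(** The order of the factors is that of the two ways of multiplying three basis
    vectors: [(w a * w b) * w c] against [w a * (w b * w c)]. *)
Definition cocycle sigma : Prop :=
  (forall a b, sigma a b != 0) /\
  (forall a b c,
     sigma a b * sigma (a * b)%g c = sigma b c * sigma a (b * c)%g).

Definition cohomologous sigma tau : Prop :=
  exists f : G -> K, (forall g, f g != 0) /\
    (forall a b, sigma a b * f (a * b)%g = f a * f b * tau a b).

Lemma cocycle1l sigma b : cocycle sigma -> sigma 1%g b = sigma 1%g 1%g.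
Proof.
case=> nz coc; have := coc 1%g 1%g b; rewrite !mul1g => /mulIf -> //.
Qed.

Lemma cocycle1r sigma a : cocycle sigma -> sigma a 1%g = sigma 1%g 1%g.
Proof.
case=> nz coc; have := coc a 1%g 1%g; rewrite !mulg1 => /mulIf -> //.
Qed.

Lemma cocycle_div sigma tau :
  cocycle sigma -> cocycle tau -> cocycle (fun a b => sigma a b / tau a b).
Proof.
move=> [nzs cs] [nzt ct]; split=> [a b|a b c].
  by rewrite mulf_neq0 ?invr_eq0.
by rewrite mulrACA -invfM cs ct invfM mulrACA.
Qed.

Lemma cocycle_prod (I : finType) (B : {set I}) (F : I -> G -> G -> K) :
    (forall i, i \in B -> cocycle (F i)) ->
  cocycle (fun a b => \prod_(i in B) F i a b).
Proof.
move=> cF; split=> [a b|a b c].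
  by apply/prodf_neq0 => i /cF[].
by rewrite -!big_split; apply: eq_bigr => i /cF[_ coc] /=; apply: coc.
Qed.

(** In the extension of [G] by [K^*] defined by [sigma], this is the commutator
    of lifts of two commuting elements [a] and [b]; it does not depend on the
    lifts. *)
Definition commutator_form sigma a b := sigma a b / sigma b a.

Lemma commutator_formV sigma a b :
  commutator_form sigma b a = (commutator_form sigma a b)^-1.
Proof. by rewrite /commutator_form invf_div. Qed.

(** The commutator is bimultiplicative because it is central: exchanging [c]
    with [a * b] amounts to exchanging it with [a] and with [b]. *)
Lemma commutator_formM sigma a b c :
    (forall x y : G, commute x y) -> cocycle sigma ->
  commutator_form sigma (a * b)%g c =
    commutator_form sigma a c * commutator_form sigma b c.
Proof.
move=> comG [nz coc].
have solve x y z t : x != 0 -> x * y = z * t -> y = z * t / x :> K.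
  by move=> x0 <-; rewrite mulrC mulKf.
have E1 := solve _ _ _ _ (nz a b) (coc a b c).
have E2 := solve _ _ _ _ (nz a b) (esym (coc c a b)).
have E3 := solve _ _ _ _ (nz c b) (esym (coc a c b)).
rewrite (comG c b) in E3; rewrite (comG c a) in E2.
rewrite /commutator_form E1 E2 E3; field.
by rewrite !nz.
Qed.
End Cocycles.

(** * Twisted algebras and their structure constants *)

Section TwistedAlgebras.
Local Open Scope ring_scope.
Variables (K : fieldType) (G : finGroupType).
Implicit Types (W V : twistedAlg K G) (sigma tau : G -> G -> K).

Lemma tw_mulZl W c (x y : W) : tw_mul (c *: x) y = c *: tw_mul x y.
Proof.
have mul0 : tw_mul 0 y = 0 :> W.
  by have := tw_mul_linear_l y (-1) 0 0; rewrite /= !scaleN1r !addNr.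
by have := tw_mul_linear_l y c x 0; rewrite /= mul0 !addr0.
Qed.

Lemma tw_mulZr W c (x y : W) : tw_mul x (c *: y) = c *: tw_mul x y.
Proof.
have mul0 : tw_mul x 0 = 0 :> W.
  by have := tw_mul_linear_r x (-1) 0 0; rewrite /= !scaleN1r !addNr.
by have := tw_mul_linear_r x c y 0; rewrite /= mul0 !addr0.
Qed.

Lemma tw_mul_suml W (I : finType) (F : I -> W) (y : W) :
  tw_mul (\sum_i F i) y = \sum_i tw_mul (F i) y.
Proof.
apply: (big_morph (fun x => tw_mul x y)) => [u v|].
  by have := tw_mul_linear_l y 1 u v; rewrite /= !scale1r.
by have := tw_mulZl 0 0 y; rewrite !scale0r.
Qed.

Lemma tw_mul_sumr W (I : finType) (F : I -> W) (x : W) :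
  tw_mul x (\sum_i F i) = \sum_i tw_mul x (F i).
Proof.
apply: (big_morph (tw_mul x)) => [u v|].
  by have := tw_mul_linear_r x 1 u v; rewrite /= !scale1r.
by have := tw_mulZr 0 x 0; rewrite !scale0r.
Qed.

Definition homogeneous_basis W sigma (w : G -> W) : Prop :=
  [/\ forall g, w g \in tw_comp W g,
      forall g, w g != 0
    & forall a b, tw_mul (w a) (w b) = sigma a b *: w (a * b)%g].

Lemma tw_comp_line W g (x : W) :
  x \in tw_comp W g -> x != 0 -> tw_comp W g = <[x]>%VS.
Proof.
move=> xg x0; apply/esym/eqP.
by rewrite eqEdim -memvE xg tw_dim1 dim_vline x0.
Qed.

Lemma homogeneous_basis_neq0 W sigma w a b :
  @homogeneous_basis W sigma w -> sigma a b != 0.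
Proof.
move=> [wg w0 wM]; have := tw_mul_neq0 (wg a) (wg b) (w0 a) (w0 b).
by rewrite wM scaler_eq0 negb_or => /andP[].
Qed.

Lemma homogeneous_basis_ex W : exists sigma w, @homogeneous_basis W sigma w.
Proof.
pose w g := vpick (tw_comp W g).
have wg g : w g \in tw_comp W g by apply: memv_pick.
have w0 g : w g != 0 by rewrite vpick0 -dimv_eq0 tw_dim1.
have /fin_all_exists[sigma wM] (p : G * G) :
    exists c, tw_mul (w p.1) (w p.2) = c *: w (p.1 * p.2)%g.
  by apply/vlineP; rewrite -(tw_comp_line (wg _)) // tw_mul_comp.
exists (fun a b => sigma (a, b)), w.
by split=> // a b; apply: (wM (a, b)).
Qed.

Lemma homogeneous_basis_cocycle W sigma w :
  @homogeneous_basis W sigma w -> tw_associative W -> cocycle sigma.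
Proof.
move=> hb asW; split=> [a b|a b c]; first exact: homogeneous_basis_neq0 hb.
have [_ w0 wM] := hb.
have := asW (w a) (w b) (w c).
rewrite !wM tw_mulZr tw_mulZl !wM !scalerA mulgA => /eqP.
by rewrite -subr_eq0 -scalerBl scaler_eq0 (negPf (w0 _)) orbF subr_eq0 => /eqP.
Qed.

(** The cast keeps the scalars in [K]: with [x g : K^o] the sum would carry the
   module structure over the regular ring of [K]. *)
Definition combination W (w : G -> W) (x : {ffun G -> K^o}) : W :=
  \sum_g (x g : K) *: w g.

Lemma combination_is_linear W (w : G -> W) : linear (combination w).
Proof.
move=> a x y; rewrite /combination scaler_sumr -big_split /=.
by apply: eq_bigr => g _; rewrite !ffunE scalerDl scalerA.
Qed.

HB.instance Definition _ W (w : G -> W) :=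
  GRing.isLinear.Build K {ffun G -> K^o} W *:%R (combination w)
    (combination_is_linear w).

Lemma combination_surj W sigma w : @homogeneous_basis W sigma w ->
  forall x, exists c, x = combination w c.
Proof.
move=> [wg w0 _] x.
have /memv_sumP[y yg ->] : x \in (\sum_(g : G) tw_comp W g)%VS.
  by rewrite tw_full memvf.
have /fin_all_exists[c yE] (g : G) : exists c, y g = c *: w g.
  by apply/vlineP; rewrite -(tw_comp_line (wg _)) // yg.
exists [ffun g => c g].
by apply: eq_bigr => g _; rewrite ffunE.
Qed.

Lemma combination_inj W sigma w : @homogeneous_basis W sigma w ->
  injective (combination w).
Proof.
move=> [wg w0 _] x y /eqP; rewrite -subr_eq0 /combination -sumrB => /eqP.
under eq_bigr do rewrite -scalerBl.
move/(directv_sum_independent (@tw_direct K G W)) => H.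
apply/ffunP => g; apply/eqP; rewrite -subr_eq0.
have /eqP := H (fun g _ => memvZ _ (wg g)) g isT.
by rewrite scaler_eq0 (negPf (w0 _)) orbF.
Qed.

Lemma combination_delta W (w : G -> W) g :
  combination w [ffun h => (h == g)%:R] = w g.
Proof.
rewrite /combination (bigD1 g) //= ffunE eqxx scale1r big1 ?addr0 // => h.
by rewrite ffunE => /negPf->; rewrite scale0r.
Qed.

Lemma homogeneous_basis_assoc W sigma w :
  @homogeneous_basis W sigma w -> cocycle sigma -> tw_associative W.
Proof.
move=> hw [_ coc] x y z; have [_ _ wM] := hw.
have [c ->] := combination_surj hw x.
have [d ->] := combination_surj hw y.
have [e ->] := combination_surj hw z.
rewrite /combination !tw_mul_suml; apply: eq_bigr => g _.
rewrite !(tw_mul_sumr _ (c g *: w g)) tw_mul_suml; apply: eq_bigr => h _.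
rewrite !tw_mul_sumr; apply: eq_bigr => k _.
rewrite !(tw_mulZl, tw_mulZr, wM) !scalerA mulgA; congr (_ *: _).
transitivity ((c g : K) * d h * e k * (sigma h k * sigma g (h * k)%g)).
  by ring.
by rewrite -coc; ring.
Qed.

Lemma same_structure_constants_iso W V sigma w v :
    @homogeneous_basis W sigma w -> @homogeneous_basis V sigma v ->
  graded_isomorphic W V.
Proof.
move=> hw hv.
pose cw := linfun (combination w); pose cv := linfun (combination v).
have cwE x : cw x = combination w x by rewrite lfunE.
have cvE x : cv x = combination v x by rewrite lfunE.
have kcw : lker cw == 0%VS.
  by apply/lker0P => x y; rewrite !cwE; apply: combination_inj hw _ _.
have kcv : lker cv == 0%VS.
  by apply/lker0P => x y; rewrite !cvE; apply: combination_inj hv _ _.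
have cwK := lker0_lfunK kcw; have cvK := lker0_lfunK kcv.
have cwVK x : cw (cw^-1%VF x) = x.
  by have [c ->] := combination_surj hw x; rewrite -cwE cwK.
have cvVK x : cv (cv^-1%VF x) = x.
  by have [c ->] := combination_surj hv x; rewrite -cvE cvK.
pose phi := (cv \o cw^-1)%VF.
have phi_w g : phi (w g) = v g.
  rewrite /phi comp_lfunE -(combination_delta w) -cwE cwK cvE.
  exact: combination_delta.
have phi_bij : bijective phi.
  exists (cw \o cv^-1)%VF => x; rewrite !comp_lfunE /=.
    by rewrite cvK cwVK.
  by rewrite cwK cvVK.
have phiM x y : phi (tw_mul x y) = tw_mul (phi x) (phi y).
  have [c ->] := combination_surj hw x; have [d ->] := combination_surj hw y.
  rewrite /combination tw_mul_suml !linear_sum /= tw_mul_suml.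
  apply: eq_bigr => a _.
  rewrite !linearZ /= tw_mulZl tw_mulZl tw_mul_sumr !linear_sum /= tw_mul_sumr.
  rewrite scaler_sumr; apply: eq_bigr => b _.
  rewrite !linearZ /= !tw_mulZr !linearZ /= !phi_w.
  have [_ _ ->] := hw; have [_ _ ->] := hv.
  by rewrite [phi (sigma a b *: _)]linearZ /= phi_w !scalerA (mulrC (d b)).
exists phi; split=> // [|g x].
  (* A surjective multiplicative map sends the unit to a unit. *)
  have [psi phiK psiK] := phi_bij.
  by rewrite -[LHS]tw_mul1r -{1}[tw_one V]psiK -phiM tw_mul1l psiK.
have [wg w0 _] := hw; have [vg _ _] := hv.
rewrite (tw_comp_line (wg g) (w0 g)) => /vlineP[c ->].
by rewrite linearZ /= phi_w memvZ.
Qed.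

Lemma homogeneous_basis_rescale V sigma tau v f :
    (forall g, f g != 0) ->
    (forall a b, sigma a b * f (a * b)%g = f a * f b * tau a b) ->
    @homogeneous_basis V tau v ->
  @homogeneous_basis V sigma (fun g => f g *: v g).
Proof.
move=> f0 fM [vg v0 vM]; split=> [g|g|a b].
- by rewrite memvZ.
- by rewrite scaler_eq0 negb_or f0 v0.
by rewrite tw_mulZl tw_mulZr vM !scalerA -fM.
Qed.

(** An isomorphism preserves each component, hence acts on it as a scalar: it
    is the same thing as a rescaling of the basis. *)
Lemma graded_isomorphicP W V sigma tau w v :
    @homogeneous_basis W sigma w -> @homogeneous_basis V tau v ->
  graded_isomorphic W V <-> cohomologous sigma tau.
Proof.
move=> hw hv; split=> [[phi [phi_bij _ phiM phi_comp]]|[f [f0 fM]]]; last first.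
  exact: same_structure_constants_iso hw (homogeneous_basis_rescale f0 fM hv).
have [wg w0 wM] := hw; have [vg v0 vM] := hv.
have /fin_all_exists[f fE] (g : G) : exists c, phi (w g) = c *: v g.
  by apply/vlineP; rewrite -(tw_comp_line (vg _)) // phi_comp.
exists f; split=> [g|a b].
  apply/eqP => fg0; have := fE g; rewrite fg0 scale0r -(linear0 phi).
  by move/(bij_inj phi_bij)/eqP; apply/negP.
have /eqP := phiM (w a) (w b).
rewrite wM linearZ /= !fE tw_mulZl tw_mulZr vM !scalerA -subr_eq0 -scalerBl.
by rewrite scaler_eq0 (negPf (v0 _)) orbF subr_eq0 => /eqP.
Qed.

Section CocycleAlgebra.
Variables (sigma : G -> G -> K) (sigma_coc : cocycle sigma).

Definition delta (g : G) : {ffun G -> K^o} := [ffun h => (h == g)%:R].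

(** The product of the group algebra, twisted by [sigma]. *)
Definition conv (x y : {ffun G -> K^o}) : {ffun G -> K^o} :=
  [ffun c => \sum_a x a * y (a^-1 * c)%g * sigma a (a^-1 * c)%g].

Lemma conv_linear_r x : linear (conv x).
Proof.
move=> k y z; apply/ffunP => c; rewrite !ffunE scaler_sumr -big_split.
by apply: eq_bigr => a _ /=; rewrite !ffunE /GRing.scale /=; ring.
Qed.

Lemma conv_linear_l y : linear (conv ^~ y).
Proof.
move=> k x z; apply/ffunP => c; rewrite !ffunE scaler_sumr -big_split.
by apply: eq_bigr => a _ /=; rewrite !ffunE /GRing.scale /=; ring.
Qed.

Lemma conv_delta a b : conv (delta a) (delta b) = sigma a b *: delta (a * b)%g.
Proof.
apply/ffunP => c; rewrite !ffunE (bigD1 a) //= big1 ?addr0.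
  rewrite !ffunE eqxx mul1r (canF_eq (mulKVg a)) /GRing.scale /= mulrC.
  by case: eqP => [->|]; rewrite ?mulKg ?mulr0.
by move=> g /negPf ga; rewrite ffunE ga !mul0r.
Qed.

Lemma delta_neq0 g : delta g != 0.
Proof.
by apply/eqP => /ffunP/(_ g)/eqP; rewrite !ffunE eqxx oner_eq0.
Qed.

Lemma ffun_delta_sum (x : {ffun G -> K^o}) : x = \sum_g x g *: delta g.
Proof.
apply/ffunP => h; rewrite sum_ffunE (bigD1 h) //= !ffunE eqxx big1.
  by rewrite addr0 /GRing.scale /= mulr1.
by move=> g; rewrite !ffunE eq_sym => /negPf->; rewrite scaler0.
Qed.

Lemma lines_direct : directv (\sum_(g : G) <[delta g]>).
Proof.
apply/directv_sum_independent => u uL u0 g _.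
have uE h : exists c, u h = c *: delta h by apply/vlineP/uL.
have [c uc] := uE g; rewrite uc.
have /ffunP/(_ g) := u0; rewrite sum_ffunE (bigD1 g) //= big1 => [|h hg].
  rewrite uc !ffunE eqxx /GRing.scale /= mulr1 addr0 => c0.
  by apply/eqP; rewrite scaler_eq0; apply/orP; left; apply/eqP.
by have [d ->] := uE h; rewrite !ffunE eq_sym (negPf hg) scaler0.
Qed.

Lemma lines_full : (\sum_(g : G) <[delta g]>)%VS = fullv.
Proof.
apply/eqP; rewrite eqEsubv subvf /=; apply/subvP => x _.
rewrite (ffun_delta_sum x); apply: memv_suml => g _.
by apply: (subvP (sumv_sup g _ _)) => //; rewrite memvZ ?memv_line.
Qed.

Lemma convZl c x y : conv (c *: x) y = c *: conv x y.
Proof.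
apply/ffunP => g; rewrite !ffunE scaler_sumr.
by apply: eq_bigr => a _; rewrite !ffunE /GRing.scale /= !mulrA.
Qed.

Lemma convZr c x y : conv x (c *: y) = c *: conv x y.
Proof.
apply/ffunP => g; rewrite !ffunE scaler_sumr.
by apply: eq_bigr => a _; rewrite !ffunE /GRing.scale /=; ring.
Qed.

Lemma dim_line_delta g : \dim <[delta g]>%VS = 1%N.
Proof. by rewrite dim_vline delta_neq0. Qed.

Lemma conv_comp a b x y :
  x \in <[delta a]>%VS -> y \in <[delta b]>%VS ->
  conv x y \in <[delta (a * b)%g]>%VS.
Proof.
move=> /vlineP[c ->] /vlineP[d ->].
by rewrite convZl convZr conv_delta !memvZ ?memv_line.
Qed.

Lemma conv_neq0 a b x y :
    x \in <[delta a]>%VS -> y \in <[delta b]>%VS -> x != 0 -> y != 0 ->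
  conv x y != 0.
Proof.
have [nz _] := sigma_coc.
move=> /vlineP[c ->] /vlineP[d ->]; rewrite !scaler_eq0 !negb_or.
move=> /andP[c0 a0] /andP[d0 b0].
by rewrite convZl convZr conv_delta !scaler_eq0 !negb_or c0 d0 nz delta_neq0.
Qed.

Lemma conv1l x : conv ((sigma 1%g 1%g)^-1 *: delta 1%g) x = x.
Proof.
have [nz _] := sigma_coc.
apply/ffunP => c; rewrite ffunE (bigD1 1%g) //= big1 => [|g /negPf g1].
  rewrite !ffunE eqxx invg1 mul1g (cocycle1l _ sigma_coc) /GRing.scale /=.
  by rewrite mulr1 addr0 mulrC mulrA mulfV ?mul1r.
by rewrite !ffunE g1 scaler0 !mul0r.
Qed.

Lemma conv1r x : conv x ((sigma 1%g 1%g)^-1 *: delta 1%g) = x.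
Proof.
have [nz _] := sigma_coc.
apply/ffunP => c; rewrite ffunE (bigD1 c) //= big1 => [|g /negPf gc].
  rewrite !ffunE mulVg eqxx (cocycle1r _ sigma_coc) /GRing.scale /=.
  by rewrite mulr1 addr0 mulfVK.
by rewrite !ffunE (canF_eq (mulKVg g)) mulg1 eq_sym gc scaler0 mulr0 mul0r.
Qed.

(** The unit is [delta 1] up to a scalar, because cocycles are not assumed
    normalized: [delta 1] acts as multiplication by [sigma 1 1]. *)
Definition cocycle_alg : twistedAlg K G :=
  @TwistedAlg K G {ffun G -> K^o} conv ((sigma 1%g 1%g)^-1 *: delta 1%g)
    (fun g => <[delta g]>%VS) conv_linear_r conv_linear_l lines_direct
    lines_full conv_comp dim_line_delta conv_neq0
    (memvZ _ (memv_line (delta 1%g))) conv1l conv1r.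

Lemma cocycle_alg_basis : @homogeneous_basis cocycle_alg sigma delta.
Proof.
split=> [g|g|a b]; [exact: memv_line | exact: delta_neq0 | exact: conv_delta].
Qed.

Lemma cocycle_alg_assoc : tw_associative cocycle_alg.
Proof. exact: homogeneous_basis_assoc cocycle_alg_basis sigma_coc. Qed.

End CocycleAlgebra.
End TwistedAlgebras.

(** * Roots of real numbers *)

Section Roots.
Local Open Scope ring_scope.
Variable R : rcfType.

Lemma pos_root (m : nat) (c : R) : (0 < m)%N -> 0 < c ->
  exists r, r ^+ m = c.
Proof.
move=> m0 c0.
have [||r _ /rootP] := @poly_ivt _ ('X^m - c%:P) 0 (1 + c).
- by rewrite addr_ge0 ?ltW.
- rewrite !hornerE expr0n (gtn_eqF m0) sub0r oppr_le0 (ltW c0) /= subr_ge0.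
  apply: le_trans (ler_eXnr m0 _); first by rewrite lerDr ler01.
  by rewrite lerDl ltW.
rewrite !hornerE => /eqP; rewrite subr_eq0 => /eqP rm.
by exists r.
Qed.

Lemma odd_root (m : nat) (c : R) : odd m -> c != 0 ->
  exists r, r ^+ m = c.
Proof.
move=> om c0; have m0 := odd_gt0 om.
case: (ltP 0 c) => [/(pos_root m0)//|c_le].
have [|r rm] := @pos_root m (- c) m0.
  by rewrite oppr_gt0 lt_neqAle c0.
by exists (- r); rewrite exprNn -signr_odd om rm mulN1r opprK.
Qed.

End Roots.

(** * Products of cyclic groups *)

Section CyclicProd.
Local Open Scope ring_scope.
Variables (k : nat) (n : 'I_k -> nat).
Local Notation G := (cyclic_prod n).
Local Notation order i := (n i).-1.+1.

Lemma cyclic_prodM (a b : G) i :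
  ((a * b)%g i = (a i + b i) %% order i :> nat)%N.
Proof. by rewrite ffunE. Qed.

Lemma cyclic_prodC (a b : G) : commute a b.
Proof.
by apply/ffunP => i; apply: val_inj; rewrite /= !cyclic_prodM addnC.
Qed.

Definition gen (i : 'I_k) : G :=
  [ffun j : 'I_k => inZp (i == j) : 'I_(order j)].

Lemma gen_exp i m j : ((gen i ^+ m)%g j = (m * (i == j)) %% order j :> nat)%N.
Proof.
elim: m => [|m IHm]; first by rewrite expg0 ffunE mod0n.
by rewrite expgS cyclic_prodM IHm ffunE /= modnDm mulSn.
Qed.

Lemma genE i j : (gen i j = (i == j) %% order j :> nat)%N.
Proof. by rewrite -[gen i]expg1 gen_exp mul1n. Qed.

Lemma gen_exp_order i : (gen i ^+ order i = 1)%g.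
Proof.
apply/ffunP => j; apply: val_inj; rewrite /= gen_exp ffunE /=.
by case: eqP => [->|_]; rewrite ?muln1 ?muln0 ?modnn ?mod0n.
Qed.

Lemma gen_decomposition (a : G) : (a = \prod_i gen i ^+ a i)%g.
Proof.
apply/ffunP => j; apply: val_inj => /=.
have -> : ((\prod_i gen i ^+ a i)%g j =
    (\sum_i a i * (i == j)) %% order j :> nat)%N.
  elim/big_rec2: _ => [|i y x _ E]; first by rewrite ffunE mod0n.
  by rewrite cyclic_prodM E gen_exp modnDm.
rewrite (bigD1 j) //= eqxx muln1 big1 ?addn0 ?modn_small //.
by move=> i /negPf->; rewrite muln0.
Qed.

(** The universal property of a product of cyclic groups among commutative
    monoids: it is presented by its generators, their commutation, and one
    power relation for each generator. *)
Lemma cyclic_prod_lift (T : Type) (idx : T) (op : Monoid.com_law idx)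
    (u : 'I_k -> T)
    (s := fun a : G => \big[op/idx]_i iter (a i) (op (u i)) idx) :
    (forall i, iter (order i) (op (u i)) idx = idx) ->
  forall a b, s (a * b)%g = op (s a) (s b).
Proof.
move=> u_order a b; rewrite /s -big_split; apply: eq_bigr => i _ /=.
have iterM p q : iter (p + q) (op (u i)) idx =
    op (iter p (op (u i)) idx) (iter q (op (u i)) idx).
  by elim: p => [|p IHp]; rewrite ?Monoid.mul1m //= IHp Monoid.mulmA.
have iter_order q : iter (q * order i) (op (u i)) idx = idx.
  by elim: q => // q IHq; rewrite mulSn iterM IHq u_order Monoid.mul1m.
rewrite cyclic_prodM -iterM {2}(divn_eq (a i + b i) (order i)).
by rewrite iterM iter_order Monoid.mul1m.
Qed.

End CyclicProd.

(** * Splitting commutative extensions *)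

Section Splitting.
Local Open Scope ring_scope.
Variables (K : fieldType) (k : nat) (n : 'I_k -> nat).
Local Notation G := (cyclic_prod n).
Local Notation order i := (n i).-1.+1.
Variable sigma : G -> G -> K.
Hypothesis sigma_coc : cocycle sigma.

(** In an associative algebra with basis vectors [w] and structure constants
    [sigma], multiplying [w 1] by [m] factors [w g] gives this scalar times
    [w (g ^+ m)]. For [g ^+ m = 1] it is the [m]-th power of [w g], as a
    multiple of the unit. *)
Definition power_constant (g : G) (m : nat) := \prod_(j < m) sigma g (g ^+ j)%g.

Lemma commutator_formX g m h :
  commutator_form sigma (g ^+ m)%g h = commutator_form sigma g h ^+ m.
Proof.
elim: m => [|m IHm].
  rewrite expg0 /commutator_form cocycle1l // cocycle1r //.
  by rewrite divff ?sigma_coc.1.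
by rewrite expgS commutator_formM ?IHm -?exprS //; apply: cyclic_prodC.
Qed.

Lemma commutator_form_order i h :
  commutator_form sigma (gen n i) h ^+ order i = 1.
Proof.
by rewrite -commutator_formX gen_exp_order -(expg0 1) commutator_formX.
Qed.

Lemma commutator_form_gen_eq1 h :
  (forall i, commutator_form sigma (gen n i) h = 1) ->
  forall g, commutator_form sigma g h = 1.
Proof.
move=> gen1 g; rewrite (gen_decomposition g).
elim/big_rec: _ => [|i y _ IH]; first by rewrite -(expg0 1) commutator_formX.
rewrite commutator_formM ?IH ?commutator_formX ?gen1 ?expr1n ?mulr1 //.
exact: cyclic_prodC.
Qed.

Lemma sym_of_gen :
    (forall i j, commutator_form sigma (gen n i) (gen n j) = 1) ->
  forall g h, sigma g h = sigma h g.
Proof.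
move=> gen1 g h; apply: divr1_eq; rewrite -/(commutator_form sigma g h).
apply: commutator_form_gen_eq1 => i; rewrite commutator_formV.
by rewrite commutator_form_gen_eq1 ?invr1 // => j; rewrite gen1.
Qed.

(** The pairs [(x, g)] form the extension of [G] defined by [sigma], including
    the pairs with [x = 0] so that it is only a monoid. It is commutative when
    [sigma] is symmetric, so a choice of lifts of the generators satisfying the
    power relations extends to a multiplicative section [s] of the projection
    to [G]; the first component of [s] trivializes [sigma]. *)
Lemma symmetric_cocycle_splits :
    (forall g h, sigma g h = sigma h g) ->
    (forall i, exists r,
       r ^+ order i * power_constant (gen n i) (order i) = 1) ->
  exists f : G -> K, (forall g, f g != 0) /\
    (forall a b, f a * f b * sigma a b = f (a * b)%g).
Proof.
have [nz coc] := sigma_coc => sym /fin_all_exists[r rE].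
pose op (x y : K * G) := (x.1 * y.1 * sigma x.2 y.2, (x.2 * y.2)%g).
pose idx : K * G := ((sigma 1%g 1%g)^-1, 1%g).
have opA : associative op.
  move=> [x a] [y b] [z c]; rewrite /op /= mulgA; congr (_, _).
  transitivity (x * y * z * (sigma b c * sigma a (b * c)%g)); first by ring.
  by rewrite -coc; ring.
have opC : commutative op.
  by move=> [x a] [y b]; rewrite /op /= sym cyclic_prodC (mulrC x).
have op1 : left_id idx op.
  by move=> [x a]; rewrite /op /= mul1g cocycle1l // mulrAC mulVf ?mul1r.
pose op' : Monoid.com_law idx :=
  HB.pack op (Monoid.isComLaw.Build _ _ op opA opC op1).
have op_iter x g m : iter m (op (x, g)) idx =
    (x ^+ m * (sigma 1%g 1%g)^-1 * power_constant g m, (g ^+ m)%g).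
  elim: m => [|m IHm].
    by rewrite /power_constant big_ord0 expr0 mul1r mulr1.
  rewrite iterS IHm /op /= -expgS /power_constant big_ord_recr exprS /=.
  by congr (_, _); ring.
pose u i := (r i, gen n i).
pose s (a : G) := \big[op'/idx]_i iter (a i) (op' (u i)) idx.
have sM a b : s (a * b)%g = op (s a) (s b).
  apply: (@cyclic_prod_lift k n _ _ op' u) => i.
  by rewrite op_iter mulrAC rE mul1r gen_exp_order.
have s2 a : (s a).2 = a.
  rewrite {2}(gen_decomposition a).
  rewrite (big_morph snd (id1 := 1%g) (op1 := mulg)) //.
  by apply: eq_bigr => i _; rewrite op_iter.
have sE a b : (s a).1 * (s b).1 * sigma a b = (s (a * b)%g).1.
  by rewrite sM /op /= !s2.
exists (fun a => (s a).1); split=> // a.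
(* [s a] is invertible, with inverse [s a^-1]. *)
have := sE a (a^-1)%g; rewrite mulgV => E.
have : (s 1%g).1 != 0.
  by rewrite /s big1 /= ?invr_eq0 // => i _; rewrite ffunE.
by rewrite -E -mulrA mulf_eq0 negb_or => /andP[].
Qed.

End Splitting.

(** * Sign invariants of real cocycles *)

Section Invariants.
Local Open Scope ring_scope.
Variables (R : rcfType) (s k : nat) (n : 'I_k -> nat).
Local Notation G := (cyclic_prod n).
Local Notation order i := (n i).-1.+1.
Implicit Types (sigma tau : G -> G -> R) (p q : 'I_k * 'I_k).

Definition even_pairs : {set 'I_k * 'I_k} :=
  [set q : 'I_k * 'I_k | (q.1 <= q.2 < s)%N].

Hypothesis order_even : forall i : 'I_k, (i < s)%N -> ~~ odd (order i).
Hypothesis order_odd : forall i : 'I_k, (s <= i)%N -> odd (order i).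

Definition invariant sigma q : R :=
  if q.1 == q.2 then power_constant sigma (gen n q.1) (order q.1)
  else commutator_form sigma (gen n q.1) (gen n q.2).

Lemma invariant_div sigma tau q :
  invariant (fun a b => sigma a b / tau a b) q =
    invariant sigma q / invariant tau q.
Proof.
rewrite /invariant; case: ifP => _; first exact: prodf_div.
by rewrite /commutator_form !invf_div !mulf_div; congr (_ / _); rewrite mulrC.
Qed.

Lemma invariant_prod (I : finType) (B : {set I}) (F : I -> G -> G -> R) q :
  invariant (fun a b => \prod_(i in B) F i a b) q =
    \prod_(i in B) invariant (F i) q.
Proof.
rewrite /invariant; case: ifP => _; first exact: exchange_big.
by rewrite /commutator_form -prodf_div.
Qed.

Lemma invariant_neq0 sigma q : cocycle sigma -> invariant sigma q != 0.
Proof.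
move=> [nz _]; rewrite /invariant /commutator_form /power_constant.
case: ifP => _; first by apply/prodf_neq0.
by rewrite mulf_neq0 ?invr_eq0.
Qed.

(** A coboundary does not change commutators, and multiplies the scalar of the
    power relation of a generator by an even power of a real number. *)
Lemma cohomologous_invariant sigma tau q :
    cohomologous sigma tau -> q \in even_pairs ->
  exists t, 0 < t /\ invariant sigma q = t * invariant tau q.
Proof.
move=> [f [f0 fM]]; rewrite inE => /andP[le_q lt_q].
have sE a b : sigma a b = f a * f b / f (a * b)%g * tau a b.
  by rewrite mulrAC -fM mulfK.
rewrite /invariant; case: eqP => [q_diag|_].
  pose g := gen n q.1; exists (f g ^+ order q.1); split.
    rewrite lt_neqAle eq_sym expf_neq0 //= real_exprn_even_ge0 ?num_real //.
    by rewrite order_even // q_diag.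
  rewrite /power_constant (eq_bigr _ (fun j _ => sE g _)) big_split /=.
  (* The factors [f (g ^+ j) / f (g ^+ j.+1)] telescope, [g] having order
     [order q.1]. *)
  congr (_ * _); under eq_bigr do rewrite -expgS -mulrA.
  rewrite !big_split /= prodr_const card_ord prodfV -[RHS]mulr1.
  congr (_ * _).
  rewrite big_ord_recl [X in _ / X]big_ord_recr /= gen_exp_order expg0.
  by rewrite (mulrC (f 1%g)) divff // mulf_neq0 //; apply/prodf_neq0.
exists 1; rewrite mul1r; split; first exact: ltr01.
rewrite /commutator_form !sE cyclic_prodC (mulrC (f (gen n q.2))).
by rewrite -mulf_div divff ?mul1r // !mulf_neq0 ?invr_eq0.
Qed.

(** The commutator is a real root of unity of odd order. *)
Lemma commutator_form_gen_odd sigma (i : 'I_k) h :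
  cocycle sigma -> (s <= i)%N -> commutator_form sigma (gen n i) h = 1.
Proof.
move=> sc /order_odd odd_i; have E := commutator_form_order sc i h.
apply/eqP; rewrite -(@pexpr_eq1 _ _ (order i)) ?E //.
by rewrite ltW // -(exprn_odd_gt0 _ odd_i) E ltr01.
Qed.

(** Commutators of even generators are real roots of unity, hence trivial once
    positive; power relations can be normalized by extracting real roots. *)
Lemma positive_invariants_split sigma : cocycle sigma ->
    (forall q, q \in even_pairs -> 0 < invariant sigma q) ->
  exists f : G -> R, (forall g, f g != 0) /\
    (forall a b, f a * f b * sigma a b = f (a * b)%g).
Proof.
move=> sc pos; have [nz _] := sc.
have comm_lt (i j : 'I_k) : (i < j)%N ->
    commutator_form sigma (gen n i) (gen n j) = 1.
  move=> lt_ij; case: (leqP s j) => [s_j|j_s].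
    by rewrite commutator_formV commutator_form_gen_odd ?invr1.
  have := pos (i, j); rewrite inE /invariant /= j_s ltnW // => /(_ isT).
  rewrite (ltn_eqF lt_ij : (i == j) = false) => c_gt0.
  apply/eqP; rewrite -(@pexpr_eq1 _ _ (order i)) ?ltW //.
  by rewrite commutator_form_order.
apply: symmetric_cocycle_splits => // [|i].
  apply: sym_of_gen => // i j; case: (ltngtP i j) => [|lt_ji|/val_inj->].
  - exact: comm_lt.
  - by rewrite commutator_formV comm_lt ?invr1.
  by rewrite /commutator_form divff.
have c0 : power_constant sigma (gen n i) (order i) != 0 by apply/prodf_neq0.
suff [r rE] : exists r,
    r ^+ order i = (power_constant sigma (gen n i) (order i))^-1.
  by exists r; rewrite rE mulVf.
case: (leqP s i) => [/order_odd i_odd|i_s].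
  by apply: (@odd_root R); rewrite ?invr_eq0.
apply: (@pos_root R) => //; rewrite invr_gt0.
by have := pos (i, i); rewrite inE /invariant /= eqxx leqnn i_s => ->.
Qed.

(** On the diagonal this is the carry of the addition in a coordinate, which
    describes the extension of Z/n by Z/2 that is cyclic of order 2n; off the
    diagonal it is a product of two characters, which describes an extension
    where two generators have commutator -1. *)
Definition elementary p (a b : G) : bool :=
  if p.1 == p.2 then (order p.1 <= a p.1 + b p.1)%N
  else odd (a p.1) && odd (b p.2).

(** Carries are associative because both sums of two carries count how many
    times [order p.1] fits in [a p.1 + b p.1 + c p.1]; the other case is
    bilinearity, parity being well defined modulo an even number. *)
Lemma elementary_cocycle p : p \in even_pairs ->
  cocycle (fun a b => (-1) ^+ elementary p a b : R).
Proof.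
rewrite inE => /andP[le_p lt_p]; split=> [a b|a b c].
  by rewrite signr_eq0.
rewrite -!signr_addb; congr (_ ^+ _); rewrite /elementary !cyclic_prodM.
case: eqP => [_|_]; last first.
  rewrite !odd_mod ?oddD; try by apply: negbTE; apply: order_even; lia.
  by do 4 case: (odd _).
move: (a p.1) (b p.1) (c p.1) => [x lx] [y ly] [z lz] /=.
move: (order p.1) lx ly lz => N lx ly lz.
have modE u v : (u < N -> v < N -> (u + v) %% N =
    if N <= u + v then u + v - N else u + v)%N.
  move=> lu lv; case: leqP => [le_N|/modn_small//].
  by rewrite -{1}(subnK le_N) modnDr modn_small //; lia.
rewrite !modE //; case: (leqP N (x + y)) => xy; case: (leqP N (y + z)) => yz.
all: by rewrite /=; repeat (case: leqP => ? //=); lia.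
Qed.

Lemma gen_even (i j : 'I_k) : (i < s)%N -> gen n i j = (i == j) :> nat.
Proof.
move=> /order_even ev; rewrite genE; case: eqP => [<-|]; last by rewrite mod0n.
by rewrite modn_small //; case: (n i).-1 ev.
Qed.

(** Among the products [e_i * e_i ^+ j] with [j < n_i], exactly the last one
    has a carry. Ordering the pairs matters off the diagonal: only one of
    [(e_i, e_j)] and [(e_j, e_i)] contributes to the commutator. *)
Lemma invariant_elementary p q : p \in even_pairs -> q \in even_pairs ->
  invariant (fun a b => (-1) ^+ elementary p a b) q = (-1) ^+ (p == q) :> R.
Proof.
case: p q => [p1 p2] [q1 q2].
rewrite !inE /= => /andP[le_p lt_p] /andP[le_q lt_q].
have lt_p1 := leq_ltn_trans le_p lt_p; have lt_q1 := leq_ltn_trans le_q lt_q.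
rewrite /invariant /elementary xpair_eqE /=.
case: (eqVneq q1 q2) => [q_diag|q_ndiag].
  subst q2; rewrite /power_constant.
  case: (eqVneq p1 p2) => [p_diag|p_ndiag]; last first.
    rewrite big1 => [|j _]; last first.
      rewrite gen_even // gen_exp; case: (eqVneq q1 p1) => //= qp.
      by rewrite (_ : (q1 == p2) = false) ?muln0 ?mod0n // qp; apply/negbTE.
    case: (p1 =P q1) p_ndiag => //= ->.
    by rewrite [p2 == _]eq_sym => /negPf->.
  subst p2; rewrite andbb; case: (eqVneq p1 q1) => [pq|pq]; last first.
    rewrite big1 // => j _.
    by rewrite gen_even // gen_exp eq_sym (negPf pq) muln0 mod0n.
  subst q1; rewrite big_ord_recr /= big1 => [|j _].
    by rewrite gen_even // gen_exp eqxx muln1 modn_small // add1n leqnn mul1r.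
  rewrite gen_even // gen_exp eqxx muln1 modn_small ?(ltn_trans (ltn_ord j)) //.
  by rewrite add1n ltnS leqNgt ltn_ord.
rewrite /commutator_form !gen_even //; case: (eqVneq p1 p2) => [p_diag|p_ndiag].
  subst p2; rewrite [X in (-1) ^+ (_ <= X)%N / _]addnC divff ?signr_eq0 //.
  by case: (p1 =P q1) q_ndiag => //= <- /negPf->.
have -> : odd (q2 == p1) && odd (q1 == p2) = false.
  rewrite !oddb; apply/negP => /andP[/eqP E1 /eqP E2]; subst p1 p2.
  by case/negP: q_ndiag; apply/eqP/val_inj/eqP; rewrite eqn_leq le_q.
by rewrite !oddb expr0 divr1 (eq_sym q1) (eq_sym q2).
Qed.

Definition sign_cocycle (B : {set 'I_k * 'I_k}) (a b : G) : R :=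
  \prod_(p in B) (-1) ^+ elementary p a b.

Lemma sign_cocycleP (B : {set 'I_k * 'I_k}) :
  B \subset even_pairs -> cocycle (sign_cocycle B).
Proof.
by move=> /subsetP sB; apply: cocycle_prod => p /sB; apply: elementary_cocycle.
Qed.

Lemma invariant_sign_cocycle (B : {set 'I_k * 'I_k}) q :
    B \subset even_pairs -> q \in even_pairs ->
  invariant (sign_cocycle B) q = (-1) ^+ (q \in B).
Proof.
move=> /subsetP sB qD; rewrite invariant_prod.
under eq_bigr => p /sB pD do rewrite invariant_elementary //.
case: (boolP (q \in B)) => qB.
  rewrite (bigD1 q) //= eqxx big1 ?mulr1 // => p /andP[_ /negPf->//].
by rewrite big1 // => p pB; case: eqP qB => // <-; rewrite pB.
Qed.

Lemma sign_cocycle_inj (B C : {set 'I_k * 'I_k}) :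
    B \subset even_pairs -> C \subset even_pairs ->
  cohomologous (sign_cocycle B) (sign_cocycle C) -> B = C.
Proof.
move=> sB sC coBC; apply/setP => q.
case: (boolP (q \in even_pairs)) => qD; last first.
  by rewrite (contraNF (subsetP sB q)) // (contraNF (subsetP sC q)).
have [t [t0]] := cohomologous_invariant coBC qD.
rewrite !invariant_sign_cocycle // => E.
have : 0 < (-1) ^+ (q \in B) * (-1) ^+ (q \in C) :> R.
  by rewrite E mulrAC -mulrA -signr_addb addbb mulr1.
by rewrite -signr_addb signr_gt0; case: (q \in B); case: (q \in C).
Qed.

(** [sigma] and the sign cocycle with the same negative invariants have a
    quotient with positive invariants, which is a coboundary. *)
Lemma sign_cocycle_surj sigma : cocycle sigma ->
  exists B : {set 'I_k * 'I_k},
    B \subset even_pairs /\ cohomologous sigma (sign_cocycle B).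
Proof.
move=> sc; pose B := [set q in even_pairs | invariant sigma q < 0].
have sB : B \subset even_pairs by apply/subsetP => q; rewrite inE => /andP[].
exists B; split=> //; have bc := sign_cocycleP sB; have [bnz _] := bc.
have [q qD|f [f0 fM]] := positive_invariants_split (cocycle_div sc bc).
  rewrite invariant_div invariant_sign_cocycle // inE qD /=.
  case: (ltP (invariant sigma q) 0) => [lt0|ge0].
    by rewrite expr1 invrN1 mulrN1 oppr_gt0.
  by rewrite expr0 divr1 lt_neqAle eq_sym invariant_neq0.
exists (fun g => (f g)^-1); split=> [g|a b]; first by rewrite invr_eq0.
have [snz _] := sc.
rewrite -fM -!invfM; field.
by rewrite !f0 bnz snz.
Qed.

Lemma card_even_pairs : (s <= k)%N -> #|even_pairs| = (s * s.+1)./2.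
Proof.
move=> le_sk; rewrite -sum1_card (eq_bigl _ _ (in_set _)).
rewrite -(pair_big_dep predT (fun i j : 'I_k => i <= j < s)%N
  (fun _ _ => 1%N)) /=.
rewrite (exchange_big_dep (fun j : 'I_k => j < s)%N) /=; last first.
  by move=> i j _ /andP[].
transitivity (\sum_(j < k | (j < s)%N) j.+1)%N.
  apply: eq_bigr => j lt_js; rewrite lt_js.
  rewrite -[RHS]card_ord -sum1_card.
  rewrite (big_ord_widen k (fun _ => 1%N) (ltn_ord j)).
  by apply: eq_bigl => i; rewrite andbT ltnS.
rewrite -(big_ord_widen k S le_sk) mulnC -(bin2 s.+1) -bin2_sum.
by rewrite big_nat_recl // add0n big_mkord.
Qed.

End Invariants.

(** * The count *)

Theorem theorem6 (R : realType) (s k : nat) (n : 'I_k -> nat)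
    (le_sk : s <= k)
    (n_gt0 : forall i : 'I_k, 0 < n i)
    (n_even : forall i : 'I_k, i < s -> ~~ odd (n i))
    (n_odd : forall i : 'I_k, s <= i -> odd (n i)) :
  count_up_to (@graded_isomorphic R (cyclic_prod n))
    (@tw_associative R (cyclic_prod n)) (2 ^ (s * s.+1)./2).
Proof.
have order_even (i : 'I_k) : i < s -> ~~ odd (n i).-1.+1.
  by rewrite prednK //; apply: n_even.
have order_odd (i : 'I_k) : s <= i -> odd (n i).-1.+1.
  by rewrite prednK //; apply: n_odd.
pose D := powerset (even_pairs s k).
have cardD : #|D| = 2 ^ (s * s.+1)./2.
  by rewrite card_powerset card_even_pairs.
rewrite -cardD.
have sub (t : 'I_#|D|) : enum_val t \subset even_pairs s k.
  by rewrite -powersetE enum_valP.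
pose cocP t := sign_cocycleP R order_even (sub t).
exists (fun t => cocycle_alg (cocP t)); split=> [t|t u|W Wassoc].
- exact: cocycle_alg_assoc.
- move/(graded_isomorphicP (cocycle_alg_basis _) (cocycle_alg_basis _)).
  by move/(sign_cocycle_inj order_even (sub t) (sub u))/enum_val_inj.
have [sigma [w hw]] := homogeneous_basis_ex W.
have [B [sB coB]] :=
  sign_cocycle_surj order_even order_odd (homogeneous_basis_cocycle hw Wassoc).
have BD : B \in D by rewrite powersetE.
exists (enum_rank_in BD B).
apply/(graded_isomorphicP hw (cocycle_alg_basis _)).
by rewrite enum_rankK_in.
Qed.
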